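(* Let $s$ be a positive integer and let $\Phi:\mathbb{R}^{n\times n}\to\mathbb{R}^m$ be a linear operator with the $s$-$|||\cdot|||_1$ Stable Null Space Property, i.e., there exists a constant $0<\rho<1$ such that $$|||H_S|||_1\le\rho\,|||H_{\sim S}|||_1$$ for every $H\in\ker\Phi$ and every $s$-sparsity pattern $S=S_1\cup\dots\cup S_n$ ($|S_j|\le s$). Let $X=(x_1,\dots,x_n)\in\mathbb{R}^{n\times n}$, $y=\Phi(X)$, and let $Z=(z_1,\dots,z_n)$ be any feasible solution of the problem $$\inf|||Z|||_1\quad\text{s.t. } Z\in\mathbb{R}^{n\times n},\ y=\Phi(Z).$$ Then $$|||Z-X|||_1\le(1-\rho)^{-1}(1+\rho)\Big(2\max_j\sigma_s(x_j)_1+\max_j\big(|z_j|_1-|x_j|_1\big)\Big).$$ In particular, if $X$ is $l_1$-column-flat and $X^*$ is a minimizer of this problem, then $$|||X^*-X|||_1\le 2(1-\rho)^{-1}(1+\rho)\max_j\sigma_s(x_j)_1.$$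
   Context: For $Z=(z_1,\dots,z_n)\in\mathbb{R}^{n\times n}$ with columns $z_j$, $|||Z|||_1:=\max_j|z_j|_1$ ($|\cdot|_1$ the vector $l_1$-norm). An $s$-sparsity pattern is a set $S=S_1\cup\dots\cup S_n$ with $S_j\subseteq\{(i,j):i=1,\dots,n\}$ and $|S_j|\le s$ for each $j$; $\sim S$ is its complement in $\{(i,j):1\le i,j\le n\}$. $H_T$ agrees with $H$ on entries in $T$ and is zero elsewhere. $X$ is $l_1$-column-flat if all $|x_j|_1$ have the same value. For a vector $v$, $\sigma_s(v)_1:=|v|_1-(|v(i_1)|+\dots+|v(i_s)|)$, where $v(i_1),\dots,v(i_s)$ are the $s$ components of $v$ with the largest absolute values. *)

(* Defs.v *)
From HB Require Import structures.
From mathcomp Require Import all_boot all_order all_algebra.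
From mathcomp Require Import reals.

Set Implicit Arguments.
Unset Strict Implicit.
Unset Printing Implicit Defensive.

Import Order.TTheory GRing.Theory Num.Theory.
Local Open Scope ring_scope.

(* The default element of the iterated maximum is itself one of the values, so
   this is the true maximum even when all the values are negative. *)
Definition maxcol (R : realType) (n : nat) (f : 'I_n.+1 -> R) : R :=
  \big[Num.max/f ord0]_(j < n.+1) f j.

Definition l1norm (R : realType) (n : nat) (v : 'cV[R]_n) : R :=
  \sum_(i < n) `|v i 0|.

Definition mxnorm1 (R : realType) (n : nat) (Z : 'M[R]_n.+1) : R :=
  maxcol (fun j => l1norm (col j Z)).

(* An entry (i, j) is given by its row i and its column j. *)
Definition sparsity_pattern (n s : nat) (S : {set 'I_n * 'I_n}) : Prop :=
  exists S_ : 'I_n -> {set 'I_n * 'I_n},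
    (forall j, S_ j \subset [set p | p.2 == j] /\ (#|S_ j| <= s)%N) /\
    S = \bigcup_(j < n) S_ j.

Definition mxrestrict (R : realType) (n : nat) (T : {set 'I_n * 'I_n})
    (H : 'M[R]_n) : 'M[R]_n :=
  \matrix_(i, j) (if (i, j) \in T then H i j else 0).

(* The s largest absolute values are the first s terms of the decreasing
   rearrangement; for s >= n these are all the components and the value is 0. *)
Definition sigma1 (R : realType) (n s : nat) (v : 'cV[R]_n) : R :=
  l1norm v - \sum_(a <- take s (sort >=%R [seq `|v i 0| | i : 'I_n])) a.

Definition l1_column_flat (R : realType) (n : nat) (X : 'M[R]_n) : Prop :=
  forall j k : 'I_n, l1norm (col j X) = l1norm (col k X).

Definition stable_NSP (R : realType) (n m s : nat)
    (Phi : {linear 'M[R]_n.+1 -> 'cV[R]_m}) (rho : R) : Prop :=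
  0 < rho < 1 /\
  forall (H : 'M[R]_n.+1) (S : {set 'I_n.+1 * 'I_n.+1}),
    Phi H = 0 -> sparsity_pattern s S ->
    mxnorm1 (mxrestrict S H) <= rho * mxnorm1 (mxrestrict (~: S) H).

Definition feasible (R : realType) (n m : nat)
    (Phi : {linear 'M[R]_n.+1 -> 'cV[R]_m}) (y : 'cV[R]_m)
    (Z : 'M[R]_n.+1) : Prop :=
  y = Phi Z.

Definition minimizer (R : realType) (n m : nat)
    (Phi : {linear 'M[R]_n.+1 -> 'cV[R]_m}) (y : 'cV[R]_m)
    (Z : 'M[R]_n.+1) : Prop :=
  feasible Phi y Z /\
  forall W : 'M[R]_n.+1, feasible Phi y W -> mxnorm1 Z <= mxnorm1 W.

(* Main.v *)
(* Let H = Z - X, which lies in the kernel, and let S collect in each column j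
   the s largest entries of x_j.  Splitting |z_j| = |x_j + h_j| over S_j and its
   complement, the triangle inequality gives
     |h_j off S_j| <= |h_j on S_j| + 2 sigma_s(x_j) + (|z_j| - |x_j|).
   Taking maxima over j and applying the null space property to H and S yields
   (1 - rho) |||H_~S||| <= D, where D is the bracket in the claim, and then
   |||H||| <= |||H_S||| + |||H_~S||| <= (1 + rho) |||H_~S|||.
   When X is column-flat, |x_j| = |||X||| >= |||X*||| >= |x*_j| for every j, so
   the second maximum in D is nonpositive. *)
Require Import Defs.
From HB Require Import structures.
From mathcomp Require Import all_boot all_order all_algebra.
From mathcomp Require Import reals lra.

Import Order.TTheory GRing.Theory Num.Theory.
Local Open Scope ring_scope.

Section MaxOfColumns.
Context {R : realType} {n : nat}.
Implicit Types (f : 'I_n.+1 -> R) (c : R).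

Lemma le_maxcol f j : f j <= maxcol f.
Proof. exact: le_bigmax. Qed.

Lemma maxcol_le f c : (forall j, f j <= c) -> maxcol f <= c.
Proof. by move=> fc; apply: bigmax_le. Qed.

End MaxOfColumns.

Section BestTerms.
Context {R : realType} {n : nat}.
Implicit Types (v : 'cV[R]_n) (A : {set 'I_n}).

(** Sorting the indices by decreasing [|v i 0|], instead of the values, keeps ties apart, so the
    first [s] terms form a set. It has min(s, n) elements, hence only [<=]. *)
Lemma sigma1_attained (s : nat) v :
  exists2 A : {set 'I_n}, (#|A| <= s)%N & sigma1 s v = \sum_(i in ~: A) `|v i 0|.
Proof.
pose f i := `|v i 0|.
pose t := sort (relpre f >=%R) (enum 'I_n).
have uniq_t : uniq (take s t) by rewrite take_uniq // sort_uniq enum_uniq.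
exists [set i in take s t].
  by rewrite cardsE (card_uniqP uniq_t) size_take_min geq_minl.
have -> : sigma1 s v = l1norm v - \sum_(i in [set i in take s t]) f i.
  rewrite /sigma1 sort_map -map_take big_map big_uniq //=.
  by congr (_ - _); apply: eq_bigl => i; rewrite inE.
rewrite /l1norm (bigID [in [set i in take s t]]) /= addrAC subrr add0r.
by apply: eq_bigl => i; rewrite !inE.
Qed.

Lemma l1norm_split A v :
  l1norm v = \sum_(i in A) `|v i 0| + \sum_(i in ~: A) `|v i 0|.
Proof.
rewrite /l1norm (bigID [in A]) /=; congr (_ + _).
by apply: eq_bigl => i; rewrite inE.
Qed.

(** On [A] the triangle inequality bounds [x] by [x + h] and [h]; off [A] it bounds [h] by [x + h]
    and [x]. Completing the part of [x] on [A] to [l1norm x] costs a second term off [A], hence the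
    factor 2. *)
Lemma l1norm_off_support_le A (x h : 'cV[R]_n) :
  \sum_(i in ~: A) `|h i 0| <=
    \sum_(i in A) `|h i 0| + 2 * \sum_(i in ~: A) `|x i 0|
    + (l1norm (x + h) - l1norm x).
Proof.
have on_A : \sum_(i in A) `|x i 0| <=
    \sum_(i in A) `|(x + h) i 0| + \sum_(i in A) `|h i 0|.
  rewrite -big_split /=; apply: ler_sum => i _.
  by rewrite mxE; have := ler_normB (x i 0 + h i 0) (h i 0); rewrite addrK.
have off_A : \sum_(i in ~: A) `|h i 0| <=
    \sum_(i in ~: A) `|(x + h) i 0| + \sum_(i in ~: A) `|x i 0|.
  rewrite -big_split /=; apply: ler_sum => i _.
  by rewrite mxE; have := ler_normB (x i 0 + h i 0) (x i 0); rewrite addrAC subrr add0r.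
rewrite (l1norm_split A x) (l1norm_split A (x + h)); lra.
Qed.

End BestTerms.

Section ColumnwisePatterns.
Context {n : nat}.
Implicit Types (A : 'I_n -> {set 'I_n}).

Definition pattern_of A : {set 'I_n * 'I_n} := [set p | p.1 \in A p.2].

Lemma sparsity_pattern_of {s : nat} {A} :
  (forall j, #|A j| <= s)%N -> sparsity_pattern s (pattern_of A).
Proof.
move=> As; exists (fun j => [set (i, j) | i in A j]); split=> [j|].
  split; first by apply/subsetP => _ /imsetP[i _ ->]; rewrite inE.
  exact: leq_trans (leq_imset_card _ _) (As j).
apply/setP => -[i j]; rewrite inE /=; apply/idP/bigcupP => [Aij|].
  by exists j => //; apply: imset_f.
by case=> k _ /imsetP[i' Ai' [-> ->]].
Qed.

(** Only column [j] of [T] is constrained, so this serves a pattern and its complement alike. *)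
Lemma l1norm_col_restrict {R : realType} {T : {set 'I_n * 'I_n}}
    {B : {set 'I_n}} {j : 'I_n} (H : 'M[R]_n) :
  (forall i, ((i, j) \in T) = (i \in B)) ->
  l1norm (col j (mxrestrict T H)) = \sum_(i in B) `|col j H i 0|.
Proof.
move=> TB; rewrite /l1norm [RHS]big_mkcond; apply: eq_bigr => i _.
by rewrite !mxE TB; case: ifP => // _; rewrite normr0.
Qed.

End ColumnwisePatterns.

Lemma mxnorm1_le_split {R : realType} {n : nat} (T : {set 'I_n.+1 * 'I_n.+1})
    (H : 'M[R]_n.+1) :
  mxnorm1 H <= mxnorm1 (mxrestrict T H) + mxnorm1 (mxrestrict (~: T) H).
Proof.
apply: maxcol_le => j.
pose B := [set i | (i, j) \in T].
rewrite (l1norm_split B) -(@l1norm_col_restrict _ _ T) => [|i]; last first.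
  by rewrite inE.
rewrite -(@l1norm_col_restrict _ _ (~: T)) => [|i]; last by rewrite !inE.
exact: lerD (le_maxcol _ j) (le_maxcol _ j).
Qed.

Theorem theorem3p2 (R : realType) (n m s : nat) (hs : (0 < s)%N)
    (Phi : {linear 'M[R]_n.+1 -> 'cV[R]_m}) (rho : R)
    (hPhi : stable_NSP s Phi rho)
    (X : 'M[R]_n.+1) (y : 'cV[R]_m) (hy : y = Phi X) :
  (forall Z : 'M[R]_n.+1, feasible Phi y Z ->
     mxnorm1 (Z - X) <=
       (1 - rho)^-1 * (1 + rho) *
         (2 * maxcol (fun j => sigma1 s (col j X))
          + maxcol (fun j => l1norm (col j Z) - l1norm (col j X))))
  /\
  (l1_column_flat X ->
   forall Xstar : 'M[R]_n.+1, minimizer Phi y Xstar ->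
     mxnorm1 (Xstar - X) <=
       2 * (1 - rho)^-1 * (1 + rho) * maxcol (fun j => sigma1 s (col j X))).
Proof.
case: hPhi => /andP[rho_gt0 rho_lt1] NSP.
have rho'_gt0 : 0 < 1 - rho by rewrite subr_gt0.
match goal with |- ?P /\ _ => have bound : P end.
  move=> Z feasZ; set sig := maxcol _; set gap := maxcol _.
  (* Finite choice: one optimal support [A j] for each column of [X]. *)
  have [A As sigmaA] := fin_all_exists2 (fun j => sigma1_attained s (col j X)).
  pose S := pattern_of A; pose H : 'M[R]_n.+1 := Z - X.
  have kerH : Phi H = 0 by rewrite linearB -feasZ hy subrr.
  have off_S : mxnorm1 (mxrestrict (~: S) H) <=
      mxnorm1 (mxrestrict S H) + (2 * sig + gap).
    apply: maxcol_le => j.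
    have on_j := le_maxcol (fun k => l1norm (col k (mxrestrict S H))) j.
    have sig_j := le_maxcol (fun k => sigma1 s (col k X)) j.
    have gap_j := le_maxcol (fun k => l1norm (col k Z) - l1norm (col k X)) j.
    have := l1norm_off_support_le (A j) (col j X) (col j H).
    have -> : col j X + col j H = col j Z.
      by rewrite -linearD /= /H addrC subrK.
    move: on_j sig_j gap_j; rewrite sigmaA -/sig -/gap -/(mxnorm1 _) /=.
    rewrite (@l1norm_col_restrict _ _ _ (A j)) => [|i]; last by rewrite inE.
    rewrite (@l1norm_col_restrict _ _ _ (~: A j)) => [|i]; last by rewrite !inE.
    lra.
  have on_S := NSP H S kerH (sparsity_pattern_of As).
  have whole := mxnorm1_le_split S H.
  rewrite -mulrA ler_pdivlMl //.
  (* Adding [on_S] and [off_S] bounds [1 - rho] times the norm off [S] by the bracket; [nra] scales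
     this by [1 + rho] and [on_S] by [1 - rho]. *)
  have := ler_wpM2l (ltW rho'_gt0) whole.
  nra.
split=> // flatX Xs [feasXs minXs].
apply: le_trans (bound Xs feasXs) _.
(* Moving the 2 next to the sigma term exposes a common nonnegative factor; what remains is that the
   gap term is at most 0. *)
rewrite -[2 * _ * _]mulrA -[leRHS]mulrA [leRHS]mulrCA ler_wpM2l //; last first.
  rewrite gerDl; apply: maxcol_le => j; rewrite subr_le0.
  apply: le_trans (le_maxcol (fun k => l1norm (col k Xs)) j) _.
  apply: le_trans (minXs X hy) _.
  by apply: maxcol_le => k; rewrite (flatX k j).
by rewrite mulr_ge0 ?invr_ge0 1?ltW // addr_gt0.
Qed.
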